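(* Consider the four pairs of operations on conditional events $(\wedge_K,\vee_K)$, $(\wedge_L,\vee_L)$, $(\wedge_B,\vee_B)$, $(\wedge_S,\vee_S)$ and the properties P1, P2a, P2b, P2c, P3, P4, P5, P6 defined in the context. Then none of the four pairs satisfies all of these properties. More precisely: (1) $(\wedge_K,\vee_K)$ satisfies P1, P2c and P4, and does not satisfy P2a, P2b, P3, P5, P6. (2) $(\wedge_L,\vee_L)$ satisfies P4, and does not satisfy P1, P2a, P2b, P2c, P3, P5, P6. (3) $(\wedge_B,\vee_B)$ satisfies P2c and P3, and does not satisfy P1, P2a, P2b, P4, P5, P6. (4) $(\wedge_S,\vee_S)$ satisfies P2c, and does not satisfy P1, P2a, P2b, P3, P4, P5, P6.
   Context: Events are elements of a Boolean algebra (sure event $\Omega$, impossible event $\emptyset$), $\overline{E}$ is negation and juxtaposition is conjunction. A conditional event $A|H$ (with $H\neq\emptyset$) is a three-valued object: true on $AH$, false on $\overline{A}H$, void on $\overline{H}$; two conditional events are equal when they have the same truth value in every case, i.e. $A|H=B|K$ iff $AH=BK$ and $H=K$. Negation: $\overline{A|H}=\overline{A}|H$. Goodman–Nguyen inclusion: $A|H\subseteq B|K$ iff $AH\subseteq BK$ and $\overline{B}K\subseteq\overline{A}H$. Conjunctions: $(A|H)\wedge_K(B|K)=AHBK\,|\,(AHBK\vee\overline{A}H\vee\overline{B}K)$; $(A|H)\wedge_L(B|K)=AHBK\,|\,(AHBK\vee\overline{A}H\vee\overline{B}K\vee\overline{H}\,\overline{K})$; $(A|H)\wedge_B(B|K)=AB|HK$;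 $(A|H)\wedge_S(B|K)=[(AH\vee\overline{H})\wedge(BK\vee\overline{K})]\,|\,(H\vee K)$. For each of them the associated disjunction is given by De Morgan's law: $(A|H)\vee_*(B|K)$ is the negation of $(\overline{A}|H)\wedge_*(\overline{B}|K)$, for $*\in\{K,L,B,S\}$. (The subscript $K$ in $\wedge_K,\vee_K$ is only a name and is unrelated to the event $K$.) A pair $(\wedge,\vee)$ satisfies one of the following properties if it holds for all events $A,H,B,K$ (in any Boolean algebra) for which the conditional events involved are defined: P1: $A|H\subseteq B|K\iff(A|H)\wedge(B|K)=A|H$. P2a: $A|H=[(A|H)\wedge(B|K)]\vee[(A|H)\wedge(\overline{B}|K)]$. P2b: $A|H=(A|H)\wedge(K|K)$. P2c: $(A|H)\wedge[(B|K)\vee(\overline{B}|K)]=[(A|H)\wedge(B|K)]\vee[(A|H)\wedge(\overline{B}|K)]$. P3: $(A|H)\vee(B|K)=(A|H)\vee[(\overline{A}|H)\wedge(B|K)]=(B|K)\vee[(A|H)\wedge(\overline{B}|K)]$. For the probabilistic properties, let $x=P(A|H)$, $y=P(B|K)$, $z=P[(A|H)\wedge(B|K)]$, $w=P[(A|H)\vee(B|K)]$; the stated relation must hold for every coherent assessment $(x,y,z,w)$ on $\{A|H,B|K,(A|H)\wedge(B|K),(A|H)\vee(B|K)\}$: P4: $z\le x\le w$ and $z\le y\le w$. P5: $w=x+y-z$. P6: $\max\{x+y-1,0\}\le z\le\min\{x,y\}$ and $\max\{x,y\}\le w\le\min\{x+y,1\}$. Coherence: a real function $P$ on a finite family of conditional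 events is coherent if, for every subfamily $\{E_1|H_1,\ldots,E_n|H_n\}$, with $p_i=P(E_i|H_i)$, and all real $s_1,\ldots,s_n$, the restriction $G_{\mathcal{H}_n}$ of $G=\sum_{i=1}^n s_iH_i(E_i-p_i)$ (events identified with their indicators) to $\mathcal{H}_n=H_1\vee\cdots\vee H_n$ satisfies $\min G_{\mathcal{H}_n}\le 0\le\max G_{\mathcal{H}_n}$. *)

(* Defs.v *)
From HB Require Import structures.
From mathcomp Require Import all_boot all_order all_algebra.
From mathcomp Require Import classical_sets reals.

Set Implicit Arguments.
Unset Strict Implicit.
Unset Printing Implicit Defensive.

Import Order.TTheory GRing.Theory Num.Theory.

Local Open Scope order_scope.

(* [Cond A H] stands for A|H.  The record does not carry the proof of H <> 0:
   the conjunctions below are partial (for instance AB|HK is meaningless when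
   HK = 0), so the condition is the separate predicate [defined]. *)
Record cond (T : Type) := Cond { event : T; given : T }.

Section ConditionalEvents.
Context {d : Order.disp_t} {T : ctbDistrLatticeType d}.
Implicit Types x y : cond T.

Definition defined x : bool := given x != \bot.

(* Equality of conditional events is having the same truth values, which is
   coarser than Leibniz equality of the pairs: A|H and AH|H are equal. *)
Definition cond_eq x y : Prop :=
  event x `&` given x = event y `&` given y /\ given x = given y.

(* Goodman-Nguyen inclusion *)
Definition cond_sub x y : Prop :=
  event x `&` given x <= event y `&` given y /\
  ~` (event y) `&` given y <= ~` (event x) `&` given x.

Definition cond_neg x : cond T := Cond (~` (event x)) (given x).

Definition and_K x y : cond T :=
  let: Cond A H := x in let: Cond B K := y in
  Cond (A `&` H `&` B `&` K)
       ((A `&` H `&` B `&` K) `|` (~` A `&` H) `|` (~` B `&` K)).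

Definition and_L x y : cond T :=
  let: Cond A H := x in let: Cond B K := y in
  Cond (A `&` H `&` B `&` K)
       ((A `&` H `&` B `&` K) `|` (~` A `&` H) `|` (~` B `&` K)
          `|` (~` H `&` ~` K)).

Definition and_B x y : cond T :=
  let: Cond A H := x in let: Cond B K := y in
  Cond (A `&` B) (H `&` K).

Definition and_S x y : cond T :=
  let: Cond A H := x in let: Cond B K := y in
  Cond (((A `&` H) `|` ~` H) `&` ((B `&` K) `|` ~` K)) (H `|` K).

End ConditionalEvents.

Notation "x =c y" := (cond_eq x y) (at level 70, no associativity).

(* An operation is given uniformly over all Boolean algebras. *)
Definition cond_op : Type :=
  forall (d : Order.disp_t) (T : ctbDistrLatticeType d),
    cond T -> cond T -> cond T.

Definition de_morgan (conj : cond_op) : cond_op :=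
  fun d T x y => cond_neg (conj d T (cond_neg x) (cond_neg y)).

Record op_pair := OpPair { op_and : cond_op; op_or : cond_op }.

Definition pair_K := OpPair (@and_K) (de_morgan (@and_K)).
Definition pair_L := OpPair (@and_L) (de_morgan (@and_L)).
Definition pair_B := OpPair (@and_B) (de_morgan (@and_B)).
Definition pair_S := OpPair (@and_S) (de_morgan (@and_S)).

Section Coherence.
Context {d : Order.disp_t} {T : ctbDistrLatticeType d} {R : realType}.
Context {n : nat}.
Variables (c : n.-tuple (cond T)) (p : n.-tuple R).
Implicit Types (J : {set 'I_n}) (e h : {ffun 'I_n -> bool}).

Definition signed (a : T) (b : bool) : T := if b then a else ~` a.

(* The events E_i, H_i (i in J) generate a finite subalgebra whose atoms are the
   nonzero constituents; on [constituent J e h] the indicators of E_i and H_i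
   are constant, equal to e i and h i. *)
Definition constituent J e h : T :=
  \meet_(i in J) (signed (event (tnth c i)) (e i)
                    `&` signed (given (tnth c i)) (h i)).

Definition gain J (s : 'I_n -> R) e h : R :=
  (\sum_(i in J) s i * (h i)%:R * ((e i)%:R - tnth p i))%R.

(* The set of values of the gain restricted to the disjunction of the
   conditioning events of the subfamily J. *)
Definition gain_values J (s : 'I_n -> R) : set R := fun g =>
  exists e h,
    [/\ constituent J e h != \bot,
        constituent J e h <= \join_(i in J) given (tnth c i)
      & g = gain J s e h].

Definition is_min (S : set R) (m : R) : Prop := S m /\ lbound S m.
Definition is_max (S : set R) (m : R) : Prop := S m /\ ubound S m.

Definition coherent : Prop :=
  forall (J : {set 'I_n}) (s : 'I_n -> R), J != finset.set0 ->
    exists m M : R, [/\ is_min (gain_values J s) m,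
                        is_max (gain_values J s) M
                      & (m <= 0 <= M)%R].

End Coherence.

(* In each property the hypothesis lists the conditional events involved;
   negations are omitted, as x and its negation have the same conditioning
   event. *)
Section Properties.
Variables (R : realType) (o : op_pair).
Local Notation "x /&\ y" := (op_and o x y) (at level 40, left associativity).
Local Notation "x \|/ y" := (op_or o x y) (at level 50, left associativity).

Definition P1 : Prop :=
  forall (d : Order.disp_t) (T : ctbDistrLatticeType d) (A H B K : T),
  let x := Cond A H in let y := Cond B K in
  all defined [:: x; y; x /&\ y] ->
  cond_sub x y <-> x /&\ y =c x.

Definition P2a : Prop :=
  forall (d : Order.disp_t) (T : ctbDistrLatticeType d) (A H B K : T),
  let x := Cond A H in let y := Cond B K in let y' := Cond (~` B) K in
  all defined [:: x; y; x /&\ y; x /&\ y'; (x /&\ y) \|/ (x /&\ y')] ->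
  x =c (x /&\ y) \|/ (x /&\ y').

Definition P2b : Prop :=
  forall (d : Order.disp_t) (T : ctbDistrLatticeType d) (A H K : T),
  let x := Cond A H in let k := Cond K K in
  all defined [:: x; k; x /&\ k] ->
  x =c x /&\ k.

Definition P2c : Prop :=
  forall (d : Order.disp_t) (T : ctbDistrLatticeType d) (A H B K : T),
  let x := Cond A H in let y := Cond B K in let y' := Cond (~` B) K in
  all defined [:: x; y; y \|/ y'; x /&\ (y \|/ y');
                  x /&\ y; x /&\ y'; (x /&\ y) \|/ (x /&\ y')] ->
  x /&\ (y \|/ y') =c (x /&\ y) \|/ (x /&\ y').

Definition P3 : Prop :=
  forall (d : Order.disp_t) (T : ctbDistrLatticeType d) (A H B K : T),
  let x := Cond A H in let x' := Cond (~` A) H in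
  let y := Cond B K in let y' := Cond (~` B) K in
  all defined [:: x; y; x \|/ y; x' /&\ y; x \|/ (x' /&\ y);
                  x /&\ y'; y \|/ (x /&\ y')] ->
  x \|/ y =c x \|/ (x' /&\ y) /\ x \|/ (x' /&\ y) =c y \|/ (x /&\ y').

Definition for_all_coherent (rel : R -> R -> R -> R -> Prop) : Prop :=
  forall (d : Order.disp_t) (T : ctbDistrLatticeType d) (A H B K : T)
         (x y z w : R),
  let a := Cond A H in let b := Cond B K in
  all defined [:: a; b; a /&\ b; a \|/ b] ->
  coherent [tuple a; b; a /&\ b; a \|/ b] [tuple x; y; z; w] ->
  rel x y z w.

Definition P4 : Prop := for_all_coherent (fun x y z w =>
  (z <= x <= w)%R /\ (z <= y <= w)%R).

Definition P5 : Prop := for_all_coherent (fun x y z w => w = (x + y - z)%R).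

Definition P6 : Prop := for_all_coherent (fun x y z w =>
  (Num.max (x + y - 1) 0 <= z <= Num.min x y)%R /\
  (Num.max x y <= w <= Num.min (x + y) 1)%R).

Definition all_properties : Prop :=
  P1 /\ P2a /\ P2b /\ P2c /\ P3 /\ P4 /\ P5 /\ P6.

End Properties.

(* Main.v *)
Require Import Defs.
From mathcomp Require Import all_boot all_order all_algebra.
From mathcomp Require Import classical_sets reals.
From mathcomp Require Import lra.

(** A conditional event is determined by the event where it is true and the
    event where it is false ([cond_eqP]), and Goodman-Nguyen inclusion says that
    truth grows while falsity shrinks.  In these terms the positive algebraic
    claims become identities of distributive lattices.  The conjunction with
    index K meets the truths and joins the falsities, and its disjunction does
    the converse, so P1 is the characterization of the order by meet and join,
    and P2c is distributivity.  For index S the same distributivity is applied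
    to the falsities, the conditioning events being joined on both sides.  For
    index B the operations act componentwise on the pair (event, conditioning
    event), and P2c and P3 reduce to Boolean identities.

    A coherent assessment is monotone for Goodman-Nguyen inclusion
    ([coherent_monotone]): if A|H is included in B|K and P(A|H) > P(B|K), the
    bet that buys A|H and sells B|K loses in every case where it is not called
    off.  With the conjunctions K and L, the conjunction is included in each
    operand and each operand in the disjunction, whence P4.

    The failures come from two quadruples of subsets of a set of four worlds.  For the
    probabilistic properties one needs an assessment that is coherent, and the
    relative frequencies of truth under the uniform weight are
    ([frequency_coherent]): they make the sum of the gain over all worlds
    vanish, and the gain is zero wherever all bets are called off, so over the
    remaining worlds it takes values of both signs or only the value zero.
    Property P2b fails for all four pairs, because conjunction with K|K can
    change the conditioning event; so no pair has all the properties. *)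

Set Implicit Arguments.
Unset Strict Implicit.
Unset Printing Implicit Defensive.

Import Order.Theory GRing.Theory Num.Theory.

Local Open Scope order_scope.

(** * Truth and falsity *)

Section TruthFalsity.
Context {d : Order.disp_t} {T : ctbDistrLatticeType d}.
Implicit Types (x y : cond T) (a b f : T).

Definition truth x : T := event x `&` given x.
Definition falsity x : T := ~` (event x) `&` given x.

Lemma given_truth_falsity x : given x = truth x `|` falsity x.
Proof. by rewrite /truth /falsity -meetUl joinxC meet1x. Qed.

Lemma truth_falsity_disjoint x : truth x `&` falsity x = \bot.
Proof.
by rewrite /truth /falsity meetACA meetxC meet0x.
Qed.

Lemma cond_eqP x y :
  x =c y <-> truth x = truth y /\ falsity x = falsity y.
Proof.
split=> [[tE gE]|[tE fE]].
  have falsityE z : falsity z = given z `&` ~` truth z.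
    by rewrite /falsity /truth complI meetUr meetxC joinx0 meetC.
  by rewrite !falsityE gE /truth tE.
by split=> //; rewrite !given_truth_falsity tE fE.
Qed.

(** A variant for index S, whose conditioning event is simpler than its
    truth. *)
Lemma cond_eqP_given x y :
  x =c y <-> falsity x = falsity y /\ given x = given y.
Proof.
split=> [/[dup] /cond_eqP[_ ->] [_ ->]//|[fE gE]]; split=> //.
have truthE z : event z `&` given z = given z `&` ~` falsity z.
  by rewrite /falsity complI complK meetUr meetxC joinx0 meetC.
by rewrite !truthE fE gE.
Qed.

Lemma truth_neg x : truth (cond_neg x) = falsity x.
Proof. by []. Qed.

Lemma falsity_neg x : falsity (cond_neg x) = truth x.
Proof. by rewrite /falsity /= complK. Qed.

(** The conjunctions K and L have this shape: conditioned on the disjunction of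
    the event [a] and of disjoint reasons [f] for being false. *)
Lemma truth_disjoint a f : truth (Cond a (a `|` f)) = a.
Proof. by rewrite /truth /= joinKI. Qed.

Lemma falsity_disjoint a f : a `&` f = \bot -> falsity (Cond a (a `|` f)) = f.
Proof.
move=> af; rewrite /falsity /= meetUr meetC meetxC join0x.
by apply/meet_idPr; rewrite -disj_leC meetC af.
Qed.

Local Notation or_K := (op_or pair_K).
Local Notation or_L := (op_or pair_L).
Local Notation or_B := (op_or pair_B).
Local Notation or_S := (op_or pair_S).

Lemma and_K_E x y : and_K x y =
  Cond (truth x `&` truth y) ((truth x `&` truth y) `|` (falsity x `|` falsity y)).
Proof.
by case: x y => [A H] [B K]; rewrite /and_K /truth /falsity /= !meetA !joinA.
Qed.

Lemma and_L_E x y : and_L x y =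
  Cond (truth x `&` truth y)
       ((truth x `&` truth y) `|`
        (falsity x `|` falsity y `|` (~` given x `&` ~` given y))).
Proof.
by case: x y => [A H] [B K]; rewrite /and_L /truth /falsity /= !meetA !joinA.
Qed.

Lemma truth_meet_falsity x y :
  (truth x `&` truth y) `&` (falsity x `|` falsity y) = \bot.
Proof.
by rewrite meetUr meetAC truth_falsity_disjoint meet0x -meetA
  truth_falsity_disjoint meetx0 joinx0.
Qed.

Lemma truth_and_K x y : truth (and_K x y) = truth x `&` truth y.
Proof. by rewrite and_K_E truth_disjoint. Qed.

Lemma falsity_and_K x y : falsity (and_K x y) = falsity x `|` falsity y.
Proof. by rewrite and_K_E falsity_disjoint// truth_meet_falsity. Qed.

Lemma truth_or_K x y : truth (or_K x y) = truth x `|` truth y.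
Proof. by rewrite truth_neg falsity_and_K !falsity_neg. Qed.

Lemma falsity_or_K x y : falsity (or_K x y) = falsity x `&` falsity y.
Proof. by rewrite falsity_neg truth_and_K !truth_neg. Qed.

Lemma truth_and_L x y : truth (and_L x y) = truth x `&` truth y.
Proof. by rewrite and_L_E truth_disjoint. Qed.

Lemma falsity_and_L x y : falsity (and_L x y) =
  falsity x `|` falsity y `|` (~` given x `&` ~` given y).
Proof.
rewrite and_L_E falsity_disjoint// meetUr truth_meet_falsity join0x.
by rewrite meetACA -[truth x `&` _]meetA meetxC meetx0 meet0x.
Qed.

Lemma truth_or_L x y : truth (or_L x y) =
  truth x `|` truth y `|` (~` given x `&` ~` given y).
Proof. by rewrite truth_neg falsity_and_L !falsity_neg. Qed.

Lemma falsity_or_L x y : falsity (or_L x y) = falsity x `&` falsity y.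
Proof. by rewrite falsity_neg truth_and_L !truth_neg. Qed.

Lemma given_or_S x y : given (or_S x y) = given x `|` given y.
Proof. by case: x y => [A H] [B K]. Qed.

Lemma falsity_and_S x y : falsity (and_S x y) = falsity x `|` falsity y.
Proof.
case: x y => [A H] [B K]; rewrite /falsity /= complI !complU !complK.
have fE (C L : T) : ~` (C `&` L) `&` L = ~` C `&` L.
  by rewrite complI meetUl meetCx joinx0.
rewrite !fE; apply/meet_idPl.
by rewrite leU2// leIr.
Qed.

(** The hypothesis makes each operand true or false wherever the other one is;
    in general a void operand counts as false in this disjunction. *)
Lemma falsity_or_S x y :
  given x = given y -> falsity (or_S x y) = falsity x `&` falsity y.
Proof.
case: x y => [A H] [B K] /= <-; rewrite falsity_neg /truth /falsity /= joinxx.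
have onH (C : T) : (C `&` H `|` ~` H) `&` H = C `&` H.
  by rewrite meetUl meetCx joinx0 -meetA meetxx.
by rewrite -[X in _ `&` X = _]meetxx [LHS]meetACA !onH.
Qed.

Lemma or_BE x y : or_B x y = Cond (event x `|` event y) (given x `&` given y).
Proof.
by case: x y => [A H] [B K]; rewrite /= /de_morgan /cond_neg /= complI !complK.
Qed.

End TruthFalsity.

(** * The positive algebraic properties *)

Lemma K_P1 : P1 pair_K.
Proof.
move=> d T A H B K x y _; rewrite cond_eqP truth_and_K falsity_and_K.
by split=> -[/meet_idPl tE /join_idPl fE]; split.
Qed.

Lemma K_P2c : P2c pair_K.
Proof.
move=> d T A H B K x y y' _; rewrite cond_eqP.
rewrite !(truth_and_K, truth_or_K, falsity_and_K, falsity_or_K).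
by split; [exact: meetUr | exact: joinIr].
Qed.

Lemma B_P2c : P2c pair_B.
Proof.
move=> d T A H B K x y y' _.
rewrite !or_BE /cond_eq /= !meetxx.
by rewrite -meetUr joinxC meetx1.
Qed.

Lemma B_P3 : P3 pair_B.
Proof.
move=> d T A H B K x x' y y' _.
rewrite !or_BE /cond_eq /=.
have -> : A `|` (~` A `&` B) = A `|` B by rewrite joinIr joinxC meet1x.
have -> : B `|` (A `&` ~` B) = A `|` B by rewrite joinIr joinxC meetx1 joinC.
by rewrite [K `&` (H `&` K)]meetCA [H `&` (H `&` K)]meetA !meetxx.
Qed.

Lemma S_P2c : P2c pair_S.
Proof.
move=> d T A H B K x y y' _; rewrite cond_eqP_given.
split; last by rewrite !given_or_S /= joinxx joinxx.
rewrite falsity_and_S !falsity_or_S// !falsity_and_S.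
exact: joinIr.
Qed.

(** * Monotonicity of coherent assessments *)

Section Monotonicity.
Context {d : Order.disp_t} {T : ctbDistrLatticeType d} {R : realType}.
Context {n : nat} (c : n.-tuple (cond T)) (p : n.-tuple R).
Implicit Types (J : {set 'I_n}) (e h : {ffun 'I_n -> bool}) (i j : 'I_n).

Lemma constituent_le J e h i : i \in J ->
  constituent c J e h <= signed (event (tnth c i)) (e i) /\
  constituent c J e h <= signed (given (tnth c i)) (h i).
Proof. by move=> iJ; apply/andP; rewrite -lexI; exact: meets_inf. Qed.

(** A nonzero event cannot lie below both [a] and its complement, so lying below
    one literal decides both. *)
Lemma le_signed (C a : T) b : C != \bot -> C <= signed a b ->
  C <= a = b /\ C <= ~` a = ~~ b.
Proof.
move=> C0; have : ~~ (C <= a `&` ~` a) by rewrite meetxC lex0.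
by rewrite lexI; case: b => /= + Ca; rewrite Ca ?andbT /= => /negbTE->.
Qed.

(** A constituent outside every conditioning event lies below the complement of
    their join; being also below the join, it would be zero. *)
Lemma constituent_given J e h : constituent c J e h != \bot ->
  constituent c J e h <= \join_(i in J) given (tnth c i) ->
  [exists i in J, h i].
Proof.
move=> + CJ; apply: contraNT => /exists_inPn noh.
rewrite -lex0 -(meetCx (\join_(i in J) given (tnth c i))) lexI CJ andbT lexC.
apply: joins_le => i iJ; rewrite lexC.
by have [_] := constituent_le e h iJ; rewrite (negbTE (noh i iJ)).
Qed.

(** The bet of unit stake on a single conditional event gains [1 - p] or [- p]. *)
Lemma coherent_prob i : coherent c p -> (0 <= tnth p i <= 1)%R.
Proof.
move=> /(_ [set i] (fun=> 1%R)).
have -> : [set i] != finset.set0 by apply/set0Pn; exists i; rewrite inE.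
move=> /(_ isT)[m [M [[[e1 [h1 [C1 D1 ->]]] _] [[e2 [h2 [C2 D2 ->]]] _]]]].
rewrite /gain !big_set1 !mul1r.
have [_ /set1P-> ->] := exists_inP (constituent_given C1 D1).
have [_ /set1P-> ->] := exists_inP (constituent_given C2 D2).
by rewrite !mul1r => /andP[]; case: (e1 i); case: (e2 i) => /=; lra.
Qed.

(** Buy [c i] and sell [c j], both with unit stake.  On a constituent where some
    bet is on, inclusion leaves the gains [p j - p i], [p j - p i - 1], [p j - 1]
    (only [c j] is on, and true) and [- p i] (only [c i] is on, and false); all
    are negative when [p j < p i], both values being in the unit interval. *)
Lemma coherent_monotone i j :
  coherent c p -> cond_sub (tnth c i) (tnth c j) -> (tnth p i <= tnth p j)%R.
Proof.
move=> coh [tij fji]; have /andP[pi0 pi1] := coherent_prob i coh.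
have /andP[pj0 pj1] := coherent_prob j coh.
rewrite leNgt; apply/negP => pji.
have ij : i != j by apply/eqP => ij; move: pji; rewrite ij ltxx.
pose s k : R := (if k == i then 1 else - 1)%R.
have J0 : [set i; j] != finset.set0 by apply/set0Pn; exists i; rewrite set21.
have [m [M [_ [[e [h [C0 CJ ->]]] _] /andP[_]]]] := coh _ s J0.
have hij : h i || h j.
  by have [k /set2P[]-> ->] := exists_inP (constituent_given C0 CJ); rewrite ?orbT.
have [/(le_signed C0)[ei ni] /(le_signed C0)[hi _]] := constituent_le e h (set21 i j).
have [/(le_signed C0)[ej nj] /(le_signed C0)[hj _]] := constituent_le e h (set22 i j).
have : e i && h i ==> e j && h j.
  by apply/implyP; rewrite -ei -hi -ej -hj -!lexI => /le_trans; apply.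
have : ~~ e j && h j ==> ~~ e i && h i.
  by apply/implyP; rewrite -ni -hi -nj -hj -!lexI => /le_trans; apply.
rewrite /gain big_setU1 ?inE//= big_set1 /s eqxx eq_sym (negbTE ij).
by move: hij; case: (e i); case: (e j); case: (h i); case: (h j) => //= _ _ _; lra.
Qed.

End Monotonicity.

Lemma P4_of_inclusions (R : realType) (o : op_pair) :
  (forall (d : Order.disp_t) (T : ctbDistrLatticeType d) (x y : cond T),
    [/\ cond_sub (op_and o x y) x, cond_sub (op_and o x y) y,
        cond_sub x (op_or o x y) & cond_sub y (op_or o x y)]) ->
  P4 R o.
Proof.
move=> incl d T A H B K x y z w a b _ coh.
have [za zb aw bw] := incl d T a b.
pose i0 := @Ordinal 4 0 isT; pose i1 := @Ordinal 4 1 isT.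
pose i2 := @Ordinal 4 2 isT; pose i3 := @Ordinal 4 3 isT.
split; apply/andP; split.
- exact: (@coherent_monotone _ _ _ _ _ _ i2 i0 coh).
- exact: (@coherent_monotone _ _ _ _ _ _ i0 i3 coh).
- exact: (@coherent_monotone _ _ _ _ _ _ i2 i1 coh).
- exact: (@coherent_monotone _ _ _ _ _ _ i1 i3 coh).
Qed.

Lemma K_P4 (R : realType) : P4 R pair_K.
Proof.
apply: P4_of_inclusions => d T x y; rewrite /cond_sub -!/(truth _) -!/(falsity _).
rewrite truth_and_K falsity_and_K truth_or_K falsity_or_K.
by rewrite leIl leIr !leUl !leUr leIl leIr.
Qed.

Lemma L_P4 (R : realType) : P4 R pair_L.
Proof.
apply: P4_of_inclusions => d T x y; rewrite /cond_sub -!/(truth _) -!/(falsity _).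
rewrite truth_and_L falsity_and_L truth_or_L falsity_or_L leIl leIr.
by split; split=> //; rewrite ?leIl ?leIr // lexUl // ?leUl ?leUr.
Qed.

(** * Coherence of relative frequencies *)

Import Order.DefaultSetSubsetOrder.

Section Frequencies.
Context {X : finType} {R : realType}.
Implicit Types (x : cond {set X}) (w : X).

Definition frequency x : R := (#|truth x|%:R / #|given x|%:R)%R.

Lemma sum_indicator (A : {set X}) : (\sum_w (w \in A)%:R = #|A|%:R :> R)%R.
Proof. by rewrite -natr_sum -sum1_card [in RHS]big_mkcond. Qed.

Section Coherence.
Context {n : nat} (c : n.-tuple (cond {set X})).
Context (c_defined : all defined c).
Implicit Types (J : {set 'I_n}) (i : 'I_n) (s : 'I_n -> R).

Definition event_at w : {ffun 'I_n -> bool} := [ffun i => w \in event (tnth c i)].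
Definition given_at w : {ffun 'I_n -> bool} := [ffun i => w \in given (tnth c i)].

Let p : n.-tuple R := map_tuple frequency c.

(** A world lies in the constituent of its own truth values, which is therefore
    nonzero. *)
Lemma world_gain_value J s w i : i \in J -> w \in given (tnth c i) ->
  gain_values c p J s (gain p J s (event_at w) (given_at w)).
Proof.
move=> iJ wi; exists (event_at w), (given_at w); split=> //.
  apply/set0Pn; exists w; apply: (big_ind (fun A : {set X} => w \in A)).
  - by rewrite inE.
  - by move=> A B wA wB; rewrite inE wA wB.
  - move=> j _; rewrite inE /event_at /given_at !ffunE /signed.
    by case: ifPn; case: ifPn; rewrite ?inE => -> ->.
have [_ Ci] := constituent_le c (event_at w) (given_at w) iJ.
apply: le_trans Ci _; rewrite /given_at ffunE wi.
exact: (joins_sup (fun k => given (tnth c k)) iJ).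
Qed.

(** Bet by bet: the sum over the worlds of [H_i (E_i - p_i)] is
    [#|E_i H_i| - p_i #|H_i|]. *)
Lemma sum_gain_worlds J s :
  (\sum_w gain p J s (event_at w) (given_at w) = 0)%R.
Proof.
rewrite /gain exchange_big /= big1// => i _.
have /all_tnthP/(_ i) Hi0 := c_defined.
have Hi : (#|given (tnth c i)|%:R != 0 :> R)%R.
  by rewrite pnatr_eq0 cards_eq0.
under eq_bigr => w _ do rewrite !ffunE mulrBr -!mulrA -natrM mulnb.
rewrite sumrB -!mulr_sumr -mulr_suml.
have -> : (\sum_w ((w \in given (tnth c i)) && (w \in event (tnth c i)))%:R =
           #|truth (tnth c i)|%:R :> R)%R.
  by rewrite -sum_indicator; apply: eq_bigr => w _; rewrite inE andbC.
by rewrite sum_indicator tnth_map /frequency [X in (_ - _ * X)%R]mulrC divfK ?subrr.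
Qed.

(** There are finitely many constituents. *)
Lemma gain_values_extrema J s : (exists g, gain_values c p J s g) ->
  exists m M, is_min (gain_values c p J s) m /\ is_max (gain_values c p J s) M.
Proof.
case=> g0 [e0 [h0 [C0 D0 _]]].
pose realized (q : {ffun 'I_n -> bool} * {ffun 'I_n -> bool}) :=
  (constituent c J q.1 q.2 != \bot) &&
  (constituent c J q.1 q.2 <= \join_(i in J) given (tnth c i)).
pose value q := gain p J s q.1 q.2.
have q0P : realized (e0, h0) by rewrite /realized C0 D0.
exists (value [arg min_(q < (e0, h0) | realized q) value q]).
exists (value [arg max_(q > (e0, h0) | realized q) value q]).
split.
  case: arg_minP => // -[e h] /andP[C D] le_eh; split; first by exists e, h.
  by move=> _ [e' [h' [C' D' ->]]]; apply: (le_eh (e', h')); rewrite /realized C' D'.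
case: arg_maxP => // -[e h] /andP[C D] le_eh; split; first by exists e, h.
by move=> _ [e' [h' [C' D' ->]]]; apply: (le_eh (e', h')); rewrite /realized C' D'.
Qed.

(** The gain sums to zero over the worlds where some bet is on, and there is one
    such world; so the gain cannot be positive on all of them, nor negative. *)
Lemma frequency_coherent : coherent c p.
Proof.
move=> J s /set0Pn[i0 i0J].
pose g w := gain p J s (event_at w) (given_at w).
pose live := [set w | [exists i in J, w \in given (tnth c i)]].
have g_live w : w \in live -> gain_values c p J s (g w).
  by rewrite inE => /exists_inP[i iJ wi]; exact: world_gain_value iJ wi.
have g_dead w : w \notin live -> g w = 0%R.
  rewrite inE => /exists_inPn noi; rewrite /g /gain big1// => i iJ.
  by rewrite /given_at ffunE (negbTE (noi i iJ)) mulr0 mul0r.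
have sum_live : (\sum_(w in live) g w = 0)%R.
  rewrite -[RHS](sum_gain_worlds J s) [RHS](bigID (mem live)) /=.
  by rewrite [X in (_ + X)%R]big1 ?addr0.
have [w0 w0live] : exists w, w \in live.
  have /all_tnthP/(_ i0)/set0Pn[w wi0] := c_defined.
  by exists w; rewrite inE; apply/exists_inP; exists i0.
have [|m [M [mP MP]]] := gain_values_extrema (J := J) (s := s).
  by exists (g w0); exact: g_live.
exists m, M; split=> //; apply/andP; split; rewrite leNgt; apply/negP => lt0.
- have gpos w : w \in live -> (0 < g w)%R.
    by move=> wl; apply: lt_le_trans lt0 _; apply: mP.2; exact: g_live.
  have := psumr_eq0P (fun w wl => ltW (gpos w wl)) sum_live w0live.
  by move=> g0; have := gpos _ w0live; rewrite g0 ltxx.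
- have gneg w : w \in live -> (0 < - g w)%R.
    move=> wl; rewrite oppr_gt0; apply: le_lt_trans lt0; apply: MP.2; exact: g_live.
  have sumN : (\sum_(w in live) - g w = 0)%R by rewrite sumrN sum_live oppr0.
  have := psumr_eq0P (fun w wl => ltW (gneg w wl)) sumN w0live.
  by move=> g0; have := gneg _ w0live; rewrite g0 ltxx.
Qed.

End Coherence.

(** The form in which probabilistic properties are refuted. *)
Lemma for_all_coherent_frequency (o : op_pair) (rel : R -> R -> R -> R -> Prop)
    (A H B K : {set X}) :
  let x := Cond A H in let y := Cond B K in
  for_all_coherent o rel ->
  all defined [:: x; y; op_and o x y; op_or o x y] ->
  rel (frequency x) (frequency y)
      (frequency (op_and o x y)) (frequency (op_or o x y)).
Proof.
move=> x y + xy_def; move/(_ _ _ A H B K); apply=> //.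
have -> : [tuple frequency x; frequency y; frequency (op_and o x y);
                 frequency (op_or o x y)] =
  map_tuple frequency [tuple x; y; op_and o x y; op_or o x y] by exact: val_inj.
exact: frequency_coherent.
Qed.

End Frequencies.

(** * Counterexamples on four equiprobable worlds *)

(** Events are given by their indicator, so that Boolean operations and
    cardinals reduce to computations on booleans ([evaluate]). *)
Definition worlds (a b c d : bool) : {set 'I_4} :=
  [set w : 'I_4 | nth false [:: a; b; c; d] w].

Lemma forall_world (P : 'I_4 -> Prop) :
  P (@Ordinal 4 0 isT) -> P (@Ordinal 4 1 isT) ->
  P (@Ordinal 4 2 isT) -> P (@Ordinal 4 3 isT) -> forall w, P w.
Proof.
by move=> P0 P1 P2 P3 [[|[|[|[|//]]]] lt_w]; rewrite (bool_irrelevance lt_w isT).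
Qed.

Lemma worldsI a b c d a' b' c' d' : worlds a b c d `&` worlds a' b' c' d' =
  worlds (a && a') (b && b') (c && c') (d && d').
Proof. by apply/setP; apply: forall_world; rewrite !inE. Qed.

Lemma worldsU a b c d a' b' c' d' : worlds a b c d `|` worlds a' b' c' d' =
  worlds (a || a') (b || b') (c || c') (d || d').
Proof. by apply/setP; apply: forall_world; rewrite !inE. Qed.

Lemma worldsC a b c d : ~` worlds a b c d = worlds (~~ a) (~~ b) (~~ c) (~~ d).
Proof. by apply/setP; apply: forall_world; rewrite !inE. Qed.

Lemma card_worlds a b c d : #|worlds a b c d| = size (filter id [:: a; b; c; d]).
Proof.
rewrite -sum1_card big_mkcond !big_ord_recl big_ord0 !inE.
by case: a b c d => [] [] [] [].
Qed.

Lemma defined_card (X : finType) (x : cond {set X}) : defined x = (0 < #|given x|)%N.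
Proof. by rewrite card_gt0. Qed.

(** Comparing cardinals is enough to tell the two sides apart in all the
    counterexamples below. *)
Lemma cond_eq_card (X : finType) (x y : cond {set X}) :
  x =c y -> #|truth x| = #|truth y| /\ #|given x| = #|given y|.
Proof. by rewrite /truth => -[-> ->]. Qed.

Ltac evaluate :=
  rewrite /truth /= /de_morgan /= ?defined_card /=;
  rewrite !(worldsI, worldsU, worldsC) /= ?card_worlds /=.

(** Discharges the hypothesis of [P] that the conditional events are defined. *)
Ltac instance P := generalize (P ltac:(by evaluate)); clear P.

Ltac refute_eq := move=> /cond_eq_card; evaluate; case.

Tactic Notation "refute_coherent" constr(A) constr(H) constr(B) constr(K) :=
  let P := fresh in
  move=> /(@for_all_coherent_frequency _ _ _ _ A H B K) P;
  instance P; rewrite /frequency; evaluate.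

Section OverlappingConditions.
(** A|H is true, false, false, void and B|K is void, false, void, false in the
    four worlds.  The two sides of P2a, P2b and P3 have conditioning events of
    different sizes, or, for P3 with index S, truths of different sizes.  The frequencies are x = 1/3 and
    y = 0, with z = 0 and w = 1/2 for the indices K and L, z = w = 0 for the
    index B, and z = w = 1/4 for the index S. *)
Local Notation A := (worlds true false false false).
Local Notation H := (worlds true true true false).
Local Notation B := (worlds false false false false).
Local Notation K := (worlds false true false true).

Lemma K_not_P2a : ~ P2a pair_K.
Proof. by move=> /(_ _ _ A H B K) P; instance P; refute_eq. Qed.

Lemma B_not_P2a : ~ P2a pair_B.
Proof. by move=> /(_ _ _ A H B K) P; instance P; refute_eq. Qed.

Lemma S_not_P2a : ~ P2a pair_S.
Proof. by move=> /(_ _ _ A H B K) P; instance P; refute_eq. Qed.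

Lemma K_not_P2b : ~ P2b pair_K.
Proof. by move=> /(_ _ _ A H K) P; instance P; refute_eq. Qed.

Lemma L_not_P2b : ~ P2b pair_L.
Proof. by move=> /(_ _ _ A H K) P; instance P; refute_eq. Qed.

Lemma B_not_P2b : ~ P2b pair_B.
Proof. by move=> /(_ _ _ A H K) P; instance P; refute_eq. Qed.

Lemma S_not_P2b : ~ P2b pair_S.
Proof. by move=> /(_ _ _ A H K) P; instance P; refute_eq. Qed.

Lemma K_not_P3 : ~ P3 pair_K.
Proof.
by move=> /(_ _ _ A H B K) P; instance P; case=> _; refute_eq.
Qed.

Lemma S_not_P3 : ~ P3 pair_S.
Proof.
by move=> /(_ _ _ A H B K) P; instance P; case; refute_eq.
Qed.

Context (R : realType).

Lemma K_not_P5 : ~ P5 R pair_K.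
Proof. by refute_coherent A H B K; lra. Qed.

Lemma L_not_P5 : ~ P5 R pair_L.
Proof. by refute_coherent A H B K; lra. Qed.

Lemma B_not_P5 : ~ P5 R pair_B.
Proof. by refute_coherent A H B K; lra. Qed.

Lemma S_not_P5 : ~ P5 R pair_S.
Proof. by refute_coherent A H B K; lra. Qed.

Lemma K_not_P6 : ~ P6 R pair_K.
Proof. by refute_coherent A H B K; rewrite !(ge_max, le_min); lra. Qed.

Lemma L_not_P6 : ~ P6 R pair_L.
Proof. by refute_coherent A H B K; rewrite !(ge_max, le_min); lra. Qed.

Lemma B_not_P4 : ~ P4 R pair_B.
Proof. by refute_coherent A H B K; lra. Qed.

Lemma S_not_P4 : ~ P4 R pair_S.
Proof. by refute_coherent A H B K; lra. Qed.

(** The bounds of P6 by [min] and [max] contain the inequalities of P4. *)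
Lemma P6_P4 (o : op_pair) : P6 R o -> P4 R o.
Proof.
move=> P6o d T A' H' B' K' x y z w a b ab_def /(P6o _ _ _ _ _ _ _ _ _ _ ab_def).
by rewrite ge_max le_min ge_max => -[/andP[_ /andP[-> ->]] /andP[/andP[-> ->] _]].
Qed.

End OverlappingConditions.

Section ImpossibleEvent.
(** A|H is false, false, void, void and B|K is false, void, true, void in the
    four worlds.  The first is included in the second, and both are void in the
    last world, where the conjunction L is false and the disjunction L true. *)
Local Notation A := (worlds false false false false).
Local Notation H := (worlds true true false false).
Local Notation B := (worlds false false true false).
Local Notation K := (worlds true false true false).

Let sub_AH_BK : cond_sub (Cond A H) (Cond B K).
Proof.
rewrite /cond_sub /= !(worldsC, worldsI); split; apply/meet_idPl; exact: worldsI.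
Qed.

Lemma L_not_P1 : ~ P1 pair_L.
Proof.
by move=> /(_ _ _ A H B K) P; instance P; case=> /(_ sub_AH_BK) + _; refute_eq.
Qed.

Lemma B_not_P1 : ~ P1 pair_B.
Proof.
by move=> /(_ _ _ A H B K) P; instance P; case=> /(_ sub_AH_BK) + _; refute_eq.
Qed.

Lemma S_not_P1 : ~ P1 pair_S.
Proof.
by move=> /(_ _ _ A H B K) P; instance P; case=> /(_ sub_AH_BK) + _; refute_eq.
Qed.

Lemma L_not_P2a : ~ P2a pair_L.
Proof. by move=> /(_ _ _ A H B K) P; instance P; refute_eq. Qed.

Lemma L_not_P2c : ~ P2c pair_L.
Proof. by move=> /(_ _ _ A H B K) P; instance P; refute_eq. Qed.

Lemma L_not_P3 : ~ P3 pair_L.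
Proof. by move=> /(_ _ _ A H B K) P; instance P; case; refute_eq. Qed.

End ImpossibleEvent.

Theorem mainTheorem3 (R : realType) :
  (~ all_properties R pair_K /\ ~ all_properties R pair_L /\
   ~ all_properties R pair_B /\ ~ all_properties R pair_S)
  /\
  ((P1 pair_K /\ P2c pair_K /\ P4 R pair_K) /\
   (~ P2a pair_K /\ ~ P2b pair_K /\ ~ P3 pair_K /\
    ~ P5 R pair_K /\ ~ P6 R pair_K))
  /\
  (P4 R pair_L /\
   (~ P1 pair_L /\ ~ P2a pair_L /\ ~ P2b pair_L /\ ~ P2c pair_L /\
    ~ P3 pair_L /\ ~ P5 R pair_L /\ ~ P6 R pair_L))
  /\
  ((P2c pair_B /\ P3 pair_B) /\
   (~ P1 pair_B /\ ~ P2a pair_B /\ ~ P2b pair_B /\ ~ P4 R pair_B /\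
    ~ P5 R pair_B /\ ~ P6 R pair_B))
  /\
  (P2c pair_S /\
   (~ P1 pair_S /\ ~ P2a pair_S /\ ~ P2b pair_S /\ ~ P3 pair_S /\
    ~ P4 R pair_S /\ ~ P5 R pair_S /\ ~ P6 R pair_S)).
Proof.
split.
  have fail o : ~ P2b o -> ~ all_properties R o by move=> notP2b [_ [_ [/notP2b]]].
  by split; [|split; [|split]]; apply: fail;
    [exact: K_not_P2b|exact: L_not_P2b|exact: B_not_P2b|exact: S_not_P2b].
split.
  split; first by split; [exact: K_P1|split; [exact: K_P2c|exact: K_P4]].
  by split; [exact: K_not_P2a|split; [exact: K_not_P2b|split; [exact: K_not_P3|
     split; [exact: K_not_P5|exact: K_not_P6]]]].
split.
  split; first exact: L_P4.
  split; first exact: L_not_P1.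
  split; first exact: L_not_P2a.
  split; first exact: L_not_P2b.
  split; first exact: L_not_P2c.
  split; first exact: L_not_P3.
  by split; [exact: L_not_P5|exact: L_not_P6].
split.
  split; first by split; [exact: B_P2c|exact: B_P3].
  split; first exact: B_not_P1.
  split; first exact: B_not_P2a.
  split; first exact: B_not_P2b.
  split; first exact: B_not_P4.
  by split; [exact: B_not_P5|move=> /P6_P4; exact: B_not_P4].
split; first exact: S_P2c.
split; first exact: S_not_P1.
split; first exact: S_not_P2a.
split; first exact: S_not_P2b.
split; first exact: S_not_P3.
split; first exact: S_not_P4.
by split; [exact: S_not_P5|move=> /P6_P4; exact: S_not_P4].
Qed.
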